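(* Let $w\le -1$ be an integer and $d:=w-1$. A set $\mathsf{H}$ of $d$-admissible arcs of the $\infty$-gon is (the set of arcs of) a $|w|$-Hom-configuration in $\mathsf{T}_w$ if and only if the following conditions hold: (1) no two distinct arcs of $\mathsf{H}$ cross, and no two distinct arcs of $\mathsf{H}$ are incident with the same vertex; (2) for every arc $\mathtt{a}\in\mathsf{H}$ there are precisely $|w|-1$ isolated vertices whose smallest overarc is $\mathtt{a}$; (3) there are at most $|w|$ isolated vertices with no overarc.
   Context: Let $K$ be an algebraically closed field, $w$ a negative integer and $d:=w-1$ (so $|d|=|w|+1$). $\mathsf{T}=\mathsf{T}_w$ denotes a $K$-linear idempotent complete algebraic triangulated category, with shift $\Sigma$, classically generated by a $w$-spherical object, i.e. an object $s$ with $\dim_K\mathrm{Hom}(s,\Sigma^i s)=1$ if $i\in\{0,w\}$ and $0$ otherwise. It is known that $\mathsf{T}$ is unique up to triangle equivalence, Krull–Schmidt with finite dimensional Hom-spaces, and $w$-Calabi–Yau: $\mathrm{Hom}(x,y)\cong D\,\mathrm{Hom}(y,\Sigma^w x)$ bifunctorially. Write $\mathrm{Ext}^i(x,y):=\mathrm{Hom}_{\mathsf{T}}(x,\Sigma^i y)$ for $i\in\mathbb{Z}$. Arc model. The vertices of the $\infty$-gon are the integers. A $d$-admissible arc is a pair $(t,u)$ of integers with $t>u$, $t-u\ge |d|-1$ and $u-t\equiv 1 \pmod d$; its endpoints are $t$ and $u$. Isomorphism classes of indecomposable objects of $\mathsf{T}$ are identified with $d$-admissible arcs in such a way that $\Sigma(t,u)=(t-1,u-1)$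 and the arrows of the Auslander–Reiten quiver are $(t,u)\to(t,u+d)$ and $(t,u)\to(t+d,u)$ whenever the target is $d$-admissible (this fixes the identification up to powers of $\Sigma$). Under it, for $x=(t,u)$ and $k:=\frac{u-t-1}{d}$, $\dim_K\mathrm{Hom}(x,y)=1$ if $y$ is a $d$-admissible arc of the form $(t+id,v)$ with $0\le i\le k-1$, $v\le u$, or of the form $(z,u-w-id)$ with $0\le i\le k-1$, $z\ge t-w$; otherwise $\mathrm{Hom}(x,y)=0$. Two arcs $(t,u)$, $(t',u')$ cross if $u<u'<t<t'$ or $u'<u<t'<t$. For a collection $X$ of objects, $X^{\perp_i}:=\{y\in\mathsf{T}\mid \mathrm{Ext}^i(x,y)=0 \text{ for all } x\in X\}$. A collection $\mathsf{H}$ of (isomorphism classes of) indecomposable objects of $\mathsf{T}$ is a $|w|$-Hom-configuration if for every indecomposable $h$: $h\in\mathsf{H}$ if and only if $h\in\mathsf{H}^{\perp_i}$ for $i=w+1,\dots,-1$ and $h\in(\mathsf{H}\setminus\{h\})^{\perp_i}$ for $i=0,w$. Given a set $\mathsf{H}$ of arcs, a vertex is isolated if it is not an endpoint of any arc in $\mathsf{H}$; an overarc of a vertex $v$ is an arc $(t,u)\in\mathsf{H}$ with $u<v<t$; the smallest overarc of $v$ is the one with $t-u$ minimal (if $v$ has an overarc). *)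

(* Defs.v *)
From mathcomp Require Import all_boot all_order all_algebra.
From mathcomp Require Import boolp classical_sets functions cardinality.

Set Implicit Arguments.
Unset Strict Implicit.
Unset Printing Implicit Defensive.

Import Order.TTheory GRing.Theory Num.Theory.
Local Open Scope classical_set_scope.
Local Open Scope ring_scope.

Declare Scope lincat_scope.

Definition has_dim (K : fieldType) (V : lmodType K) (n : nat) : Prop :=
  exists f : {linear V -> 'rV[K]_n}, bijective f.

Record linCat (K : fieldType) := LinCat {
  Ob :> Type;
  Hom : Ob -> Ob -> lmodType K;
  idm : forall x, Hom x x;
  comp : forall x y z, Hom y z -> Hom x y -> Hom x z;
  comp_assoc : forall x y z t (h : Hom z t) (g : Hom y z) (f : Hom x y),
    comp h (comp g f) = comp (comp h g) f;
  comp_idl : forall x y (f : Hom x y), comp (idm y) f = f;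
  comp_idr : forall x y (f : Hom x y), comp f (idm x) = f;
  comp_linearl : forall x y z (f : Hom x y),
    linear (fun g : Hom y z => comp g f);
  comp_linearr : forall x y z (g : Hom y z),
    linear (fun f : Hom x y => comp g f)
}.

Notation "g ∘ f" := (comp g f) (at level 40, left associativity) : lincat_scope.
Local Open Scope lincat_scope.

Section LinCat.
Variables (K : fieldType) (C : linCat K).
Implicit Types x y z b : C.

Definition is_iso x y (f : Hom x y) : Prop :=
  exists g : Hom y x, g ∘ f = idm x /\ f ∘ g = idm y.

Definition iso x y : Prop := exists f : Hom x y, is_iso f.

Definition is_zero x : Prop := idm x = 0.

Definition is_biproduct x y b (i1 : Hom x b) (i2 : Hom y b)
    (p1 : Hom b x) (p2 : Hom b y) : Prop :=
  [/\ p1 ∘ i1 = idm x, p2 ∘ i2 = idm y, p1 ∘ i2 = 0, p2 ∘ i1 = 0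
    & i1 ∘ p1 + i2 ∘ p2 = idm b].

Definition additive_cat : Prop :=
  (exists z : C, is_zero z) /\
  (forall x y, exists b (i1 : Hom x b) (i2 : Hom y b) (p1 : Hom b x)
     (p2 : Hom b y), is_biproduct i1 i2 p1 p2).

Definition indecomposable x : Prop :=
  ~ is_zero x /\
  forall y z (i1 : Hom y x) (i2 : Hom z x) (p1 : Hom x y) (p2 : Hom x z),
    is_biproduct i1 i2 p1 p2 -> is_zero y \/ is_zero z.

Definition idempotent_complete : Prop :=
  forall x (e : Hom x x), e ∘ e = e ->
    exists y (p : Hom x y) (i : Hom y x), p ∘ i = idm y /\ i ∘ p = e.

Definition split_mono x y (f : Hom x y) : Prop :=
  exists g : Hom y x, g ∘ f = idm x.

Definition split_epi x y (f : Hom x y) : Prop :=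
  exists g : Hom y x, f ∘ g = idm y.

Definition irreducible_mor x y (f : Hom x y) : Prop :=
  [/\ ~ split_mono f, ~ split_epi f
    & forall z (g : Hom x z) (h : Hom z y), f = h ∘ g ->
        split_mono g \/ split_epi h].

(* Arrows of the Auslander-Reiten quiver, without multiplicity. *)
Definition AR_arrow x y : Prop := exists f : Hom x y, irreducible_mor f.

Definition is_kernel x y z (i : Hom x y) (p : Hom y z) : Prop :=
  p ∘ i = 0 /\
  forall t (f : Hom t y), p ∘ f = 0 -> exists! g : Hom t x, i ∘ g = f.

Definition is_cokernel x y z (i : Hom x y) (p : Hom y z) : Prop :=
  p ∘ i = 0 /\
  forall t (f : Hom y t), f ∘ i = 0 -> exists! g : Hom z t, g ∘ p = f.

Definition is_pushout x y x' y' (i : Hom x y) (f : Hom x x')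
    (g : Hom y y') (i' : Hom x' y') : Prop :=
  g ∘ i = i' ∘ f /\
  forall t (u : Hom y t) (v : Hom x' t), u ∘ i = v ∘ f ->
    exists! h : Hom y' t, h ∘ g = u /\ h ∘ i' = v.

Definition is_pullback y z y' z' (p : Hom y z) (f : Hom z' z)
    (g : Hom y' y) (p' : Hom y' z') : Prop :=
  p ∘ g = f ∘ p' /\
  forall t (u : Hom t y) (v : Hom t z'), p ∘ u = f ∘ v ->
    exists! h : Hom t y', g ∘ h = u /\ p' ∘ h = v.

End LinCat.

Record linFun (K : fieldType) (C D : linCat K) := LinFun {
  fob :> C -> D;
  fmap : forall x y, Hom x y -> Hom (fob x) (fob y);
  fmap_linear : forall x y, linear (@fmap x y);
  fmap_id : forall x, fmap (idm x) = idm (fob x);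
  fmap_comp : forall x y z (g : Hom y z) (f : Hom x y),
    fmap (g ∘ f) = fmap g ∘ fmap f
}.

(* The suspension [sh] is an autoequivalence with chosen quasi-inverse [shi];
   it need not be a strict automorphism. *)
Record triCat (K : fieldType) := TriCat {
  tcat :> linCat K;
  tcat_additive : additive_cat tcat;
  sh : linFun tcat tcat;
  shi : linFun tcat tcat;
  sh_shi : exists e : forall x : tcat, Hom (sh (shi x)) x,
    (forall x, is_iso (e x)) /\
    (forall (x y : tcat) (f : Hom x y),
       e y ∘ fmap sh (fmap shi f) = f ∘ e x);
  shi_sh : exists e : forall x : tcat, Hom (shi (sh x)) x,
    (forall x, is_iso (e x)) /\
    (forall (x y : tcat) (f : Hom x y),
       e y ∘ fmap shi (fmap sh f) = f ∘ e x);
  dist : forall x y z : tcat,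
    Hom x y -> Hom y z -> Hom z (sh x) -> Prop;
  dist_iso : forall (x y z x' y' z' : tcat)
      (f : Hom x y) (g : Hom y z) (h : Hom z (sh x))
      (f' : Hom x' y') (g' : Hom y' z') (h' : Hom z' (sh x'))
      (a : Hom x x') (b : Hom y y') (c : Hom z z'),
    is_iso a -> is_iso b -> is_iso c ->
    b ∘ f = f' ∘ a -> c ∘ g = g' ∘ b -> fmap sh a ∘ h = h' ∘ c ->
    dist f g h -> dist f' g' h';
  dist_id : forall x z : tcat, is_zero z ->
    dist (idm x) (0 : Hom x z) (0 : Hom z (sh x));
  dist_cone : forall (x y : tcat) (f : Hom x y),
    exists (z : tcat) (g : Hom y z) (h : Hom z (sh x)), dist f g h;
  dist_rotate : forall (x y z : tcat)
      (f : Hom x y) (g : Hom y z) (h : Hom z (sh x)),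
    dist f g h <-> dist g h (- fmap sh f);
  dist_fill : forall (x y z x' y' z' : tcat)
      (f : Hom x y) (g : Hom y z) (h : Hom z (sh x))
      (f' : Hom x' y') (g' : Hom y' z') (h' : Hom z' (sh x'))
      (a : Hom x x') (b : Hom y y'),
    dist f g h -> dist f' g' h' -> b ∘ f = f' ∘ a ->
    exists c : Hom z z', c ∘ g = g' ∘ b /\ fmap sh a ∘ h = h' ∘ c;
  dist_octahedron : forall (x y z x' y' z' : tcat)
      (f : Hom x y) (a : Hom y z') (a' : Hom z' (sh x))
      (g : Hom y z) (b : Hom z x') (b' : Hom x' (sh y))
      (c : Hom z y') (c' : Hom y' (sh x)),
    dist f a a' -> dist g b b' -> dist (g ∘ f) c c' ->
    exists (u : Hom z' y') (v : Hom y' x'),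
      [/\ dist u v (fmap sh a ∘ b'), u ∘ a = c ∘ g, c' ∘ u = a',
          v ∘ c = b & b' ∘ v = fmap sh f ∘ c']
}.

(* Quillen's axioms; inflations and deflations are the two legs of [confl]. *)
Record exactCat (K : fieldType) := ExactCat {
  ecat :> linCat K;
  ecat_additive : additive_cat ecat;
  confl : forall x y z : ecat, Hom x y -> Hom y z -> Prop;
  confl_ker : forall (x y z : ecat) (i : Hom x y) (p : Hom y z),
    confl i p -> is_kernel i p /\ is_cokernel i p;
  confl_iso : forall (x y z x' y' z' : ecat)
      (i : Hom x y) (p : Hom y z) (i' : Hom x' y') (p' : Hom y' z')
      (a : Hom x x') (b : Hom y y') (c : Hom z z'),
    is_iso a -> is_iso b -> is_iso c ->
    b ∘ i = i' ∘ a -> c ∘ p = p' ∘ b -> confl i p -> confl i' p';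
  infl_id : forall x : ecat, exists (z : ecat) (p : Hom x z), confl (idm x) p;
  defl_id : forall z : ecat, exists (x : ecat) (i : Hom x z), confl i (idm z);
  infl_comp : forall (x y z u v : ecat) (i : Hom x y) (j : Hom y z)
      (p : Hom y u) (q : Hom z v),
    confl i p -> confl j q ->
    exists (t : ecat) (r : Hom z t), confl (j ∘ i) r;
  defl_comp : forall (x y z u v : ecat) (p : Hom x y) (q : Hom y z)
      (i : Hom u x) (j : Hom v y),
    confl i p -> confl j q ->
    exists (t : ecat) (r : Hom t x), confl r (q ∘ p);
  infl_pushout : forall (x y z x' : ecat) (i : Hom x y) (p : Hom y z)
      (f : Hom x x'),
    confl i p ->
    exists (y' z' : ecat) (g : Hom y y') (i' : Hom x' y') (p' : Hom y' z'),
      is_pushout i f g i' /\ confl i' p';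
  defl_pullback : forall (x y z z' : ecat) (i : Hom x y) (p : Hom y z)
      (f : Hom z' z),
    confl i p ->
    exists (y' x' : ecat) (g : Hom y' y) (p' : Hom y' z') (i' : Hom x' y'),
      is_pullback p f g p' /\ confl i' p'
}.

Section Frobenius.
Variables (K : fieldType) (E : exactCat K).

Definition injective_obj (q : E) : Prop :=
  forall (x y z : E) (i : Hom x y) (p : Hom y z) (f : Hom x q),
    confl i p -> exists g : Hom y q, g ∘ i = f.

Definition projective_obj (q : E) : Prop :=
  forall (x y z : E) (i : Hom x y) (p : Hom y z) (f : Hom q z),
    confl i p -> exists g : Hom q y, p ∘ g = f.

Definition frobenius : Prop :=
  [/\ forall x : E, exists (q y : E) (i : Hom x q) (p : Hom q y),
        injective_obj q /\ confl i p,
      forall x : E, exists (q y : E) (i : Hom y q) (p : Hom q x),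
        projective_obj q /\ confl i p
    & forall q : E, injective_obj q <-> projective_obj q].

Definition factors_projective (x y : E) (f : Hom x y) : Prop :=
  exists (q : E) (g : Hom x q) (h : Hom q y),
    projective_obj q /\ f = h ∘ g.

End Frobenius.

(* [T] is triangle equivalent to the stable category of a K-linear Frobenius
   category [E].  The equivalence is given as a functor [G] on [E] itself:
   full, essentially surjective, and killing exactly the morphisms that vanish
   in the stable category.  Exactness is given by the connecting morphisms
   [delta]: on a conflation [x -> q -> s] with [q] injective, [delta] is an
   isomorphism [G s -> sh (G x)], i.e. the comparison of [G] with the two
   suspensions; naturality then forces [delta] on any conflation to be the image
   of the third morphism of the corresponding standard triangle. *)
Definition algebraic (K : fieldType) (T : triCat K) : Prop :=
  exists (E : exactCat K) (G : linFun E T),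
    [/\ frobenius E,
        forall (x y : E) (f : Hom (G x) (G y)),
          exists g : Hom x y, fmap G g = f,
        forall t : T, exists x : E, iso (G x) t,
        forall (x y : E) (f : Hom x y),
          fmap G f = 0 <-> factors_projective f
      & exists delta : forall (x y z : E) (i : Hom x y) (p : Hom y z),
            confl i p -> Hom (G z) (sh T (G x)),
        (forall (x y z : E) (i : Hom x y) (p : Hom y z) (c : confl i p),
           dist (fmap G i) (fmap G p) (delta x y z i p c)) /\
        (forall (x y z x' y' z' : E) (i : Hom x y) (p : Hom y z)
             (i' : Hom x' y') (p' : Hom y' z')
             (c : confl i p) (c' : confl i' p')
             (f : Hom x x') (g : Hom y y') (h : Hom z z'),
           g ∘ i = i' ∘ f -> h ∘ p = p' ∘ g ->
           delta x' y' z' i' p' c' ∘ fmap G h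
           = fmap (sh T) (fmap G f) ∘ delta x y z i p c)].

Section Tw.
Variables (K : fieldType) (T : triCat K).

Definition shift (i : int) (x : T) : T :=
  match i with
  | Posz n => iter n (sh T) x
  | Negz n => iter n.+1 (shi T) x
  end.

Definition Ext (i : int) (x y : T) : lmodType K := Hom x (shift i y).

Definition spherical (w : int) (s : T) : Prop :=
  forall i : int,
    has_dim (Ext i s s) (if (i == 0) || (i == w) then 1%N else 0%N).

Definition thick (P : set T) : Prop :=
  [/\ forall x, P x -> P (sh T x),
      forall x, P x -> P (shi T x),
      forall (x y z : T) (f : Hom x y) (g : Hom y z) (h : Hom z (sh T x)),
        dist f g h -> P x -> P y -> P z
    & forall (x y : T) (i : Hom y x) (p : Hom x y),
        p ∘ i = idm y -> P x -> P y].

Definition classically_generates (s : T) : Prop :=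
  forall P : set T, thick P -> P s -> forall x, P x.

Definition is_Tw (w : int) : Prop :=
  [/\ idempotent_complete T, algebraic T
    & exists s : T, spherical w s /\ classically_generates s].

Definition perp (i : int) (X : set T) : set T :=
  [set y | forall x, X x -> forall f : Ext i x y, f = 0].

(* Isomorphism classes are handled as isomorphism-closed sets of objects;
   accordingly [H \ {h}] removes the whole isomorphism class of [h]. *)
Definition hom_configuration (w : int) (H : set T) : Prop :=
  [/\ forall h, H h -> indecomposable h,
      forall h h', iso h h' -> H h -> H h'
    & forall h, indecomposable h ->
        (H h <->
           (forall i : int, w + 1 <= i <= -1 -> perp i H h) /\
           (forall i : int, i = 0 \/ i = w ->
              perp i (H `\` [set x | iso x h]) h))].

End Tw.

Notation zarc := (int * int)%type.

Definition admissible (w : int) (a : zarc) : bool :=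
  let d := w - 1 in
  [&& a.2 < a.1, `|d| - 1 <= a.1 - a.2 & (a.2 - a.1 == 1 %[mod d])%Z].

Definition arc_hom (w : int) (x y : zarc) : Prop :=
  let d := w - 1 in
  let: (t, u) := x in
  let k := ((u - t - 1) %/ d)%Z in
  (exists i v : int, [/\ 0 <= i <= k - 1, v <= u & y = (t + i * d, v)]) \/
  (exists i z : int, [/\ 0 <= i <= k - 1, t - w <= z
                       & y = (z, u - w - i * d)]).

(* The known description of the indecomposables of T_w by arcs.  The values of
   [M] at pairs that are not admissible are irrelevant. *)
Record arc_model (K : fieldType) (T : triCat K) (w : int) (M : zarc -> T) :
    Prop := ArcModel {
  arc_indec : forall a, admissible w a -> indecomposable (M a);
  arc_surj : forall x : T, indecomposable x ->
    exists2 a, admissible w a & iso x (M a);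
  arc_inj : forall a b, admissible w a -> admissible w b ->
    iso (M a) (M b) -> a = b;
  arc_shift : forall t u : int, admissible w (t, u) ->
    iso (sh T (M (t, u))) (M (t - 1, u - 1));
  arc_AR : forall (t u : int) b, admissible w (t, u) -> admissible w b ->
    (AR_arrow (M (t, u)) (M b) <->
     b = (t, u + (w - 1)) \/ b = (t + (w - 1), u));
  arc_hom1 : forall a b, admissible w a -> admissible w b ->
    arc_hom w a b -> has_dim (Hom (M a) (M b)) 1;
  arc_hom0 : forall a b, admissible w a -> admissible w b ->
    ~ arc_hom w a b -> has_dim (Hom (M a) (M b)) 0
}.

Definition arc_objects (K : fieldType) (T : triCat K) (M : zarc -> T)
  (H : set zarc) : set T := [set x | exists2 a, H a & iso x (M a)].

Definition crossing (a b : zarc) : bool :=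
  (a.2 < b.2 < a.1) && (a.1 < b.1) || (b.2 < a.2 < b.1) && (b.1 < a.1).

Definition endpoint (a : zarc) (v : int) : bool := (v == a.1) || (v == a.2).

Definition isolated (H : set zarc) (v : int) : Prop :=
  forall a, H a -> ~~ endpoint a v.

Definition overarc (H : set zarc) (v : int) (a : zarc) : Prop :=
  H a /\ a.2 < v < a.1.

Definition smallest_overarc (H : set zarc) (v : int) (a : zarc) : Prop :=
  overarc H v a /\ forall b, overarc H v b -> a.1 - a.2 <= b.1 - b.2.

(* Main.v *)
Require Import Defs.
From mathcomp Require Import all_boot all_order all_algebra.
From mathcomp Require Import boolp classical_sets functions cardinality.
From mathcomp Require Import finmap.
From mathcomp Require Import zify.

Import Order.TTheory GRing.Theory Num.Theory.
Local Open Scope classical_set_scope.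
Local Open Scope card_scope.
Local Open Scope ring_scope.
Local Open Scope lincat_scope.
Import Defs.

(** Put [m := |w| + 1 = 1 - w].  An admissible arc [(t, u)] is one with
    [t - u = k m - 1] for some [k >= 1], so that its closed interval [[u, t]]
    consists of [k m] vertices.

    Translation into arcs.  In the definition of a [|w|]-Hom-configuration the
    degrees [w, ..., 0] occur, so for two distinct arcs [a], [b] all the spaces
    [Hom(a, b + j)] with [0 <= j <= |w|] are required to vanish, where [b + j] is
    the arc [b] moved by [j].  As [j] runs
    through these [m] consecutive values, each endpoint of [b + j] meets every
    residue class modulo [m] once, and the description of the Hom-spaces by arcs
    becomes a statement about the real positions of the endpoints: all these
    spaces vanish if and only if [a] and [b] neither cross nor share an endpoint
    ([apart_arc_hom]).  For [a = b] the inner degrees impose nothing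
    ([arc_hom_self]).  Hence [H] is a Hom-configuration if and only if it is a
    maximal set of pairwise non-crossing, endpoint-disjoint admissible arcs
    ([hom_configurationP]).

    Counting modulo [m].  Let [[p, q]] be an interval such that no arc of [H]
    has exactly one endpoint in it, and call a vertex of [[p, q]] free if it is
    isolated and lies under no arc contained in [[p, q]].  The other vertices
    are partitioned into the closed intervals of the outermost arcs in [[p, q]],
    each of which has a multiple of [m] elements.  Therefore the [j]-th free
    vertex (counted from [0]) is congruent to [p + j], and the number of free
    vertices is congruent to [q - p + 1], modulo [m] ([free_seq]).

    If [H] is maximal, an interval of this kind has fewer than [m] free
    vertices, for otherwise the free vertices of index [0] and [m - 1] would be
    the endpoints of an admissible arc that could be added ([free_seq_lt]).
    Applied to the interior of an arc of [H], which has [-2] vertices modulo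
    [m], this gives exactly [m - 2 = |w| - 1] isolated vertices; applied to an
    interval spanned by isolated vertices without overarc, it bounds the number
    of those by [m - 1 = |w|].  Conversely, if an arc [b] can be added to [H],
    the interval of [b] has a positive number of free vertices, divisible by
    [m]; they all have the same overarcs, so they contradict the count for the
    smallest arc over [b], or the outer bound if there is none
    ([counts_maximal]). *)

(** * Isomorphisms in linear categories *)

Lemma comp_f0 (K : fieldType) (C : linCat K) (x y z : C) (g : Hom y z) :
  g ∘ (0 : Hom x y) = 0.
Proof.
have := comp_linearr g (-1) 0 (0 : Hom x y).
by rewrite !scaleN1r !addNr.
Qed.
Lemma comp_0f (K : fieldType) (C : linCat K) (x y z : C) (f : Hom x y) :
  (0 : Hom y z) ∘ f = 0.
Proof.
have := comp_linearl f (-1) 0 (0 : Hom y z).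
by rewrite !scaleN1r !addNr.
Qed.

Lemma iso_refl (K : fieldType) (C : linCat K) (x : C) : iso x x.
Proof. by exists (idm x), (idm x); rewrite comp_idl. Qed.

Lemma iso_sym (K : fieldType) (C : linCat K) (x y : C) : iso x y -> iso y x.
Proof. by case=> f [g [gf fg]]; exists g, f. Qed.

Lemma iso_trans (K : fieldType) (C : linCat K) (x y z : C) :
  iso x y -> iso y z -> iso x z.
Proof.
case=> f [f' [f'f ff']] [g [g' [g'g gg']]]; exists (g ∘ f), (f' ∘ g'); split.
  by rewrite -comp_assoc (comp_assoc g') g'g comp_idl.
by rewrite -comp_assoc (comp_assoc f) ff' comp_idl.
Qed.

Lemma iso_fob (K : fieldType) (C D : linCat K) (F : linFun C D) (x y : C) :
  iso x y -> iso (F x) (F y).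
Proof.
case=> f [g [gf fg]]; exists (fmap F f), (fmap F g).
by rewrite -!fmap_comp gf fg !fmap_id.
Qed.

(** Vanishing of a Hom-space only depends on the isomorphism classes. *)
Lemma Hom_eq0_iso (K : fieldType) (C : linCat K) (x x' y y' : C) :
    iso x x' -> iso y y' ->
  (forall f : Hom x' y', f = 0) -> forall f : Hom x y, f = 0.
Proof.
case=> a [a' [a'a aa']] [b [b' [b'b bb']]] h f.
have := h (b ∘ f ∘ a') => e.
rewrite -[f]comp_idl -b'b -[f in LHS]comp_idr -a'a.
have -> : b' ∘ b ∘ (f ∘ (a' ∘ a)) = b' ∘ (b ∘ f ∘ a') ∘ a.
  by rewrite !comp_assoc.
by rewrite e comp_f0 comp_0f.
Qed.

Lemma is_zero_iso (K : fieldType) (C : linCat K) (x y : C) :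
  iso x y -> is_zero x -> is_zero y.
Proof.
case=> a [a' [a'a aa']] e; rewrite /is_zero -aa' -[a]comp_idr e.
by rewrite comp_f0 comp_0f.
Qed.

Lemma indecomposable_iso (K : fieldType) (C : linCat K) (x y : C) :
  iso x y -> indecomposable x -> indecomposable y.
Proof.
move=> xy [nz dec]; split=> [/(is_zero_iso _ _ _ _ (iso_sym _ _ _ _ xy))//|].
case: xy => a [a' [a'a aa']] z t i1 i2 p1 p2 [h1 h2 h3 h4 h5].
apply: (dec z t (a' ∘ i1) (a' ∘ i2) (p1 ∘ a) (p2 ∘ a)).
have cancel z1 z2 (p : Hom y z1) (i : Hom z2 y) : p ∘ a ∘ (a' ∘ i) = p ∘ i.
  by rewrite comp_assoc -(comp_assoc p) aa' comp_idr.
split; rewrite ?cancel //.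
have Dl (u v : Hom y y) : (u + v) ∘ a = u ∘ a + v ∘ a.
  by have := comp_linearl a 1 u v; rewrite !scale1r.
have Dr (u v : Hom x y) : a' ∘ (u + v) = a' ∘ u + a' ∘ v.
  by have := comp_linearr a' 1 u v; rewrite !scale1r.
by rewrite -a'a -[a in RHS]comp_idl -h5 Dl Dr !comp_assoc.
Qed.

Lemma has_dim0 (K : fieldType) (V : lmodType K) :
  has_dim V 0 -> forall v : V, v = 0.
Proof. by case=> f /bij_inj inj_f v; apply: inj_f; rewrite !thinmx0. Qed.

Lemma has_dim1 (K : fieldType) (V : lmodType K) :
  has_dim V 1 -> ~ forall v : V, v = 0.
Proof.
case=> f [g gK fK] V0; have := fK 1; rewrite (V0 (g 1)) linear0 => /eqP.
by rewrite eq_sym oner_eq0.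
Qed.

(** * Arcs and their morphisms *)

(** With [m = 1 - w = |d|], an arc is admissible when its length is [k m - 1]
    for some [k >= 1]; this [k] is the parameter in the Hom formula. *)
Lemma admissibleP (w : int) (a : zarc) : w <= -1 ->
  admissible w a <-> exists2 k : int, 1 <= k & a.1 - a.2 = k * (1 - w) - 1.
Proof.
move=> hw; split.
  case/and3P => lt_ut hlen; rewrite eqz_mod_dvd => /dvdzP[q hq].
  exists q; nia.
case=> k k_ge1 hk; apply/and3P; split; [nia | nia |].
by rewrite eqz_mod_dvd; apply/dvdzP; exists k; lia.
Qed.

Lemma admissible_lt (w : int) (a : zarc) : admissible w a -> a.2 < a.1.
Proof. by case/and3P. Qed.

(** Two arcs are apart when their closed intervals are disjoint or one lies in
    the interior of the other, i.e. they neither cross nor share an endpoint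
    ([apartP]).  An arc is not apart from itself. *)
Definition apart (a b : zarc) : bool :=
  [|| a.1 < b.2, b.1 < a.2, (a.2 < b.2) && (b.1 < a.1)
    | (b.2 < a.2) && (a.1 < b.1)].

Lemma apartP (a b : zarc) : a.2 < a.1 -> b.2 < b.1 ->
  apart a b <->
  ~~ crossing a b /\ ~ (exists v : int, endpoint a v && endpoint b v).
Proof.
move=> ha hb; rewrite /apart /crossing; split.
  move=> hab; split; first by lia.
  by case=> v; rewrite /endpoint; lia.
case=> hcross hv.
have h v : ~~ (endpoint a v && endpoint b v) by apply/negP => ?; apply: hv; exists v.
move: (h a.1) (h a.2); rewrite /endpoint; lia.
Qed.

(** The translate of an arc by [j]; [translate (- i)] describes the [i]-th power
    of the suspension. *)
Definition translate (j : int) (b : zarc) : zarc := (b.1 + j, b.2 + j).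

Lemma admissible_translate (w j : int) (b : zarc) :
  w <= -1 -> admissible w b -> admissible w (translate j b).
Proof.
move=> hw /(admissibleP w b hw)[k k1 hk]; apply/(admissibleP _ _ hw).
by exists k => //=; lia.
Qed.

(** The Hom formula with both families of targets indexed by the same [i]: the
    vertices [a.1 - i (1 - w)] and [a.2 - w + i (1 - w)], for [0 <= i < k], run
    over the same set of [k] vertices. *)
Lemma arc_homP (w : int) (a b : zarc) (k : int) : w <= -1 ->
    a.1 - a.2 = k * (1 - w) - 1 ->
  arc_hom w a b <->
  exists2 i : int, 0 <= i <= k - 1 &
    b.1 = a.1 - i * (1 - w) /\ b.2 <= a.2 \/
    b.2 = a.2 - w + i * (1 - w) /\ a.1 - w <= b.1.
Proof.
move=> hw; case: a b => [t u] [t' u'] /= htu.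
have hk : ((u - t - 1) %/ (w - 1))%Z = k by nia.
rewrite /arc_hom hk; split.
  case=> [[i [v [hi hv [-> ->]]]]|[i [z [hi hz [-> ->]]]]]; exists i => //.
    by left; lia.
  by right; lia.
case=> i hi [[-> hu]|[-> ht]]; [left; exists i, u'|right; exists i, t'];
  by split=> //; congr (_, _); lia.
Qed.

(** For given [a] and [b] at most one [j] in [[0, - w]] moves [b.1] (resp. [b.2])
    onto a vertex of the residue class used by the Hom formula, so the
    congruences disappear and only inequalities between endpoints remain. *)
Lemma apart_arc_hom (w : int) (a b : zarc) : w <= -1 ->
    admissible w a -> admissible w b ->
  apart a b <->
  forall j : int, 0 <= j <= - w -> ~ arc_hom w a (translate j b).
Proof.
move=> hw ha hb; case/(admissibleP _ _ hw): (ha) => k k1 hk.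
case/(admissibleP _ _ hw): (hb) => l l1 hl; split.
  move=> hab j hj /(arc_homP _ _ _ k hw hk)[i hi] /=.
  rewrite /apart in hab.
  case=> -[e le].
    have : k - i - l <= 0 by nia.
    nia.
  have : -1 < i + l - k by nia.
  nia.
move=> h; apply: contraT => hab; exfalso.
have [c1|c2] : (b.2 <= a.2 <= b.1 /\ b.1 <= a.1) \/
    (a.2 <= b.2 <= a.1 /\ a.1 <= b.1).
  have := admissible_lt _ _ ha; have := admissible_lt _ _ hb.
  move: hab; rewrite /apart; lia.
  (* the largest i with b.1 <= a.1 - i (1 - w), which leaves 0 <= j <= - w *)
  pose i := ((a.1 - b.1) %/ (1 - w))%Z.
  have hi : i * (1 - w) <= a.1 - b.1 < i * (1 - w) + (1 - w) by rewrite /i; lia.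
  apply: (h (a.1 - b.1 - i * (1 - w))); first by lia.
  apply/(arc_homP _ _ _ k hw hk); exists i => /=; first by nia.
  left; split; first by lia.
  have : k - i - l <= 0 by nia.
  nia.
(* the smallest i with b.2 <= a.2 - w + i (1 - w) *)
pose i := ((b.2 - a.2) %/ (1 - w))%Z.
have hi : i * (1 - w) <= b.2 - a.2 < i * (1 - w) + (1 - w) by rewrite /i; lia.
apply: (h (a.2 - w + i * (1 - w) - b.2)); first by lia.
apply/(arc_homP _ _ _ k hw hk); exists i => /=; first by nia.
right; split; first by lia.
have : -1 < i + l - k by nia.
nia.
Qed.

(** An arc satisfies the vanishing in the degrees [w + 1, ..., -1] with respect
    to itself. *)
Lemma arc_hom_self (w : int) (a : zarc) (j : int) : w <= -1 ->
  admissible w a -> 1 <= j <= - w - 1 -> ~ arc_hom w a (translate j a).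
Proof.
move=> hw /(admissibleP _ _ hw)[k k1 hk] hj /(arc_homP _ _ _ k hw hk)[i hi] /=.
by case=> -[e le]; nia.
Qed.

(** * Hom-configurations as maximal sets of arcs *)

Lemma translateD (i j : int) (b : zarc) :
  translate i (translate j b) = translate (i + j) b.
Proof. by rewrite /translate /=; congr (_, _); lia. Qed.

Lemma translate0 (b : zarc) : translate 0 b = b.
Proof. by case: b => u t; rewrite /translate /= !addr0. Qed.

Lemma shift_arc (K : fieldType) (T : triCat K) (w : int) (M : zarc -> T)
    (b : zarc) (x : T) (i : int) :
    w <= -1 -> arc_model w M -> admissible w b -> iso x (M b) ->
  iso (shift i x) (M (translate (- i) b)).
Proof.
move=> hw hM hb xb.
have adm j : admissible w (translate j b) by apply: admissible_translate.
have shM j : iso (sh T (M (translate j b))) (M (translate (j - 1) b)).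
  rewrite addrC -translateD; exact: (arc_shift hM (adm j)).
have shiM j : iso (shi T (M (translate j b))) (M (translate (j + 1) b)).
  have [e [iso_e _]] := shi_sh T.
  apply: iso_trans (ex_intro _ _ (iso_e (M (translate (j + 1) b)))).
  apply: iso_fob; apply: iso_sym; have := shM (j + 1).
  by rewrite addrK.
case: i => n /=.
  elim: n => [|n IHn] /=; first by rewrite translate0.
  apply: iso_trans (iso_fob _ _ _ (sh T) _ _ IHn) _.
  by have := shM (- n%:Z); congr (iso _ (M (translate _ b))); lia.
suff h k : iso (iter k (shi T) x) (M (translate k%:Z b)) by exact: (h n.+1).
elim: k => [|k IHk] /=; first by rewrite translate0.
apply: iso_trans (iso_fob _ _ _ (shi T) _ _ IHk) _.
by have := shiM k%:Z; congr (iso _ (M (translate _ b))); lia.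
Qed.

Lemma Ext_eq0P (K : fieldType) (T : triCat K) (w : int) (M : zarc -> T)
    (a b : zarc) (x y : T) (i : int) :
    w <= -1 -> arc_model w M -> admissible w a -> admissible w b ->
    iso x (M a) -> iso y (M b) ->
  (forall f : Ext i x y, f = 0) <-> ~ arc_hom w a (translate (- i) b).
Proof.
move=> hw hM ha hb xa yb.
have hib : admissible w (translate (- i) b) by apply: admissible_translate.
have yib := shift_arc _ _ _ _ _ _ i hw hM hb yb.
split=> [h0 hom|nhom].
  apply: (has_dim1 _ _ (arc_hom1 hM ha hib hom)).
  by apply: Hom_eq0_iso h0; exact: iso_sym.
apply: (Hom_eq0_iso _ _ _ _ _ _ xa yib).
exact: has_dim0 (arc_hom0 hM ha hib nhom).
Qed.

(** Under the arc model, Hom-configurations are the sets of arcs that are equal to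
    the set of arcs apart from all other members. *)
Lemma hom_configurationP (K : fieldType) (T : triCat K) (w : int)
    (M : zarc -> T) (H : set zarc) :
    w <= -1 -> arc_model w M -> (forall a, H a -> admissible w a) ->
  hom_configuration w (arc_objects M H) <->
  forall b, admissible w b -> H b <-> forall a, H a -> a <> b -> apart a b.
Proof.
move=> hw hM hH.
have objP b x : admissible w b -> iso x (M b) -> arc_objects M H x <-> H b.
  move=> hb xb; split=> [[a Ha xa]|Hb]; last by exists b.
  suff -> : b = a by [].
  apply: (arc_inj hM hb (hH _ Ha)); apply: iso_trans xa.
  exact: iso_sym.
have perpP b x : admissible w b -> iso x (M b) ->
    ((forall i : int, w + 1 <= i <= -1 -> perp i (arc_objects M H) x) /\
     (forall i : int, i = 0 \/ i = w ->
        perp i (arc_objects M H `\` [set y | iso y x]) x)) <->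
    forall a, H a -> a <> b -> apart a b.
  move=> hb xb; split=> [[h1 h2] a Ha ab|h].
    apply/(apart_arc_hom _ _ _ hw (hH _ Ha) hb) => j hj.
    rewrite -[j]opprK; apply/(Ext_eq0P _ _ _ _ _ _ (M a) x _ hw hM (hH _ Ha) hb
      (iso_refl _ _ _) xb).
    have HMa : arc_objects M H (M a) by exists a => //; exact: iso_refl.
    have [hi|hi] : w + 1 <= - j <= -1 \/ (- j = 0 \/ - j = w) by lia.
      exact: h1 hi _ HMa.
    apply: (h2 _ hi); split=> // Max; apply: ab.
    apply: (arc_inj hM (hH _ Ha) hb); exact: iso_trans xb.
  split=> i hi y.
    case=> a Ha ya; apply/(Ext_eq0P _ _ _ _ _ _ y x _ hw hM (hH _ Ha) hb ya xb).
    have [<-|ab] := pselect (a = b).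
      by apply: arc_hom_self (hH _ Ha) _ => //; lia.
    by apply: (iffLR (apart_arc_hom _ _ _ hw (hH _ Ha) hb) (h _ Ha ab)); lia.
  case=> -[a Ha ya] yx.
  apply/(Ext_eq0P _ _ _ _ _ _ y x _ hw hM (hH _ Ha) hb ya xb).
  have ab : a <> b.
    by move=> eab; apply: yx; apply: iso_trans ya _; rewrite eab; exact: iso_sym.
  by apply: (iffLR (apart_arc_hom _ _ _ hw (hH _ Ha) hb) (h _ Ha ab)); lia.
split=> [[_ _ hconf] b hb|hmax].
  have Mb := iso_refl _ _ (M b).
  rewrite -(objP b (M b) hb Mb) -(perpP b (M b) hb Mb).
  by apply: hconf; apply: arc_indec hb.
split.
- move=> x [a Ha xa]; apply: (indecomposable_iso _ _ (M a)).
    exact: iso_sym.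
  exact: arc_indec hM _ (hH _ Ha).
- move=> x y xy [a Ha xa]; exists a => //; apply: iso_trans xa.
  exact: iso_sym.
- move=> x /(arc_surj hM)[b hb xb].
  by rewrite (objP b x hb xb) (perpP b x hb xb); exact: hmax.
Qed.

(** * Cardinalities and sequences *)

Lemma card_eq_seq (V : choiceType) (s : seq V) (A : set V) :
  uniq s -> (forall v, A v <-> v \in s) -> A #= `I_(size s).
Proof.
move=> us sA.
have -> : A = [set` [fset x in s]%fset].
  by apply/seteqP; split=> v; rewrite /= in_fset sA.
by apply/card_eq_fsetP; rewrite card_fseq undup_id.
Qed.

Lemma seq_card_le (V : choiceType) (s : seq V) (A : set V) (n : nat) :
  uniq s -> (forall v, v \in s -> A v) -> A #<= `I_n -> (size s <= n)%N.
Proof.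
move=> us sA An; rewrite -card_le_II.
apply: card_le_trans An.
have /card_eqPle[_] := card_eq_seq _ s [set` s] us (fun=> iff_refl _).
by move/card_le_trans; apply; exact: subset_card_le.
Qed.

Lemma card_leNP (V : choiceType) (A : set V) (n : nat) :
  ~ (A #<= `I_n) -> exists s : seq V, [/\ uniq s, forall v, v \in s -> A v
    & (n < size s)%N].
Proof.
move=> nAn; have [Afin|Ainf] := pselect (finite_set A); last first.
  have [B BA sB] := infinite_set_fset n.+1 Ainf.
  by exists (enum_fset B); split=> //; exact: fset_uniq.
exists (enum_fset (fset_set A)); split; first exact: fset_uniq.
  by move=> v; rewrite in_fset_set // => /set_mem.
rewrite ltnNge; apply/negP => h; apply: nAn.
have /finite_setP[k Ak] := Afin.
rewrite (card_le_eql Ak) card_le_II -(card_fset_set Ak) //.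
Qed.

Lemma seq_has_min (disp : Order.disp_t) (V : orderType disp) (s : seq V) :
  s != [::] -> exists2 p, p \in s & forall v, v \in s -> (p <= v)%O.
Proof.
case: s => // x s _; elim: s x => [|y s IHs] x.
  by exists x; rewrite ?inE // => v; rewrite inE => /eqP->.
have [p ps minp] := IHs y; have [xp|px] := leP x p.
  exists x; first by rewrite inE eqxx.
  by move=> v; rewrite inE => /orP[/eqP->//|/minp]; exact: le_trans.
exists p; first by rewrite inE ps orbT.
by move=> v; rewrite inE => /orP[/eqP->|/minp//]; exact: ltW.
Qed.

(** * Free vertices in intervals *)

(** No two distinct arcs of [H] cross or share an endpoint. *)
Definition pairwise_apart (H : set zarc) : Prop :=
  forall a b, H a -> H b -> a <> b -> apart a b.

(** No arc of [H] has exactly one endpoint in the interval [[p, q]]. *)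
Definition uncut (H : set zarc) (p q : int) : Prop :=
  forall a, H a -> (p <= a.1 <= q) = (p <= a.2 <= q).

(** The vertex [v] is isolated and has no overarc contained in [[p, q]]; overarcs
    that leave [[p, q]] are allowed. *)
Definition free_in (H : set zarc) (p q v : int) : Prop :=
  isolated H v /\
  forall a, H a -> ~~ [&& p <= a.2, a.2 < v < a.1 & a.1 <= q].

(** The free vertices of an uncut interval, in increasing order, with their
    residues modulo [1 - w].  The interval is consumed from the left: its first
    vertex is either the left endpoint of an arc, whose whole interval is then
    skipped, or free. *)
Lemma free_seq (w : int) (H : set zarc) (L : nat) (p q : int) :
    w <= -1 -> (forall a, H a -> admissible w a) -> pairwise_apart H ->
    uncut H p q -> q - p + 1 = L%:Z ->
  exists l : seq int,
    [/\ sorted <%R l, forall v, v \in l <-> p <= v <= q /\ free_in H p q v,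
        forall j : nat, (j < size l)%N ->
          exists c : int, l`_j = p + j%:Z + c * (1 - w)
      & exists c : int, (size l)%:Z = L%:Z + c * (1 - w)].
Proof.
move=> hw hH apH; elim/ltn_ind: L p => L IHL p unc hL.
case: (posnP L) => [L0|Lgt0].
  exists [::]; split=> //; first by move=> v; rewrite in_nil; split=> // -[]; lia.
  by exists 0; rewrite L0 mul0r.
have [[a Ha a2]|nleft] := pselect (exists2 a, H a & a.2 = p).
  have [k k1 hk] := iffLR (admissibleP _ _ hw) (hH _ Ha).
  have a1 : p < a.1 <= q.
    by have := unc _ Ha; have := admissible_lt _ _ (hH _ Ha); lia.
  have unc' : uncut H (a.1 + 1) q.
    move=> b Hb; have := unc _ Hb.
    have := admissible_lt _ _ (hH _ Hb).
    have [->|ab] := pselect (b = a); first by lia.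
    by have := apH _ _ Hb Ha ab; rewrite /apart; lia.
  have ltL : (`|q - a.1| < L)%N by lia.
  have eqL : q - (a.1 + 1) + 1 = `|q - a.1|%N by lia.
  have [l [lsort lP lres [c hc]]] := IHL _ ltL _ unc' eqL.
  exists l; split=> //.
  - move=> v; rewrite lP; split=> -[hv [iv fv]].
      split; first by lia.
      split=> // b Hb; have := fv _ Hb.
      have [->|ab] := pselect (b = a); first by lia.
      have := apH _ _ Hb Ha ab; have := admissible_lt _ _ (hH _ Hb).
      by rewrite /apart; lia.
    split; first by have := fv _ Ha; have := iv _ Ha; rewrite /endpoint; lia.
    by split=> // b Hb; have := fv _ Hb; lia.
  - move=> j /lres[c' ->]; exists (c' + k); lia.
  - exists (c - k); lia.
have nright a : H a -> a.1 != p.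
  by move=> Ha; have := unc _ Ha; have := admissible_lt _ _ (hH _ Ha); lia.
have nleft' a : H a -> a.2 != p by move=> Ha; apply/eqP => e; apply: nleft; exists a.
have unc' : uncut H (p + 1) q.
  by move=> b Hb; have := unc _ Hb; have := nleft' _ Hb; have := nright _ Hb; lia.
have ltL : (L.-1 < L)%N by lia.
have eqL : q - (p + 1) + 1 = L.-1 by lia.
have [l [lsort lP lres [c hc]]] := IHL _ ltL _ unc' eqL.
exists (p :: l); split.
- rewrite /= path_sortedE ?lsort ?andbT; last exact: lt_trans.
  by apply/allP => v /lP[hv _] /=; lia.
- move=> v; rewrite inE; split.
    case/orP => [/eqP->|/lP[hv [iv fv]]].
      split; first by lia.
      split=> a Ha; last by lia.
      by have := nright _ Ha; have := nleft' _ Ha; rewrite /endpoint; lia.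
    split; first by lia.
    by split=> // a Ha; have := fv _ Ha; have := nleft' _ Ha; lia.
  case=> hv [iv fv]; have [//|vp] := eqVneq v p.
  apply/lP; split; first by lia.
  by split=> // a Ha; have := fv _ Ha; lia.
- case=> [_|j /= /lres[c' ->]]; first by exists 0; rewrite /=; lia.
  by exists c'; lia.
- by exists c => /=; lia.
Qed.

(** A maximal [H] leaves at most [|w|] free vertices in an uncut interval. *)
Lemma free_seq_lt (w : int) (H : set zarc) (p q : int) (l : seq int) :
    w <= -1 -> (forall a, H a -> admissible w a) ->
    (forall b, admissible w b -> H b <-> forall a, H a -> a <> b -> apart a b) ->
    uncut H p q -> sorted <%R l ->
    (forall v, v \in l -> p <= v <= q /\ free_in H p q v) ->
    (forall j : nat, (j < size l)%N ->
       exists c : int, l`_j = p + j%:Z + c * (1 - w)) ->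
  (size l <= `|w|)%N.
Proof.
move=> hw hH maxH unc lsort lP lres; rewrite leqNgt; apply/negP => hl.
have hl0 : (0 < size l)%N by apply: leq_ltn_trans hl.
have [c0 e0] := lres 0%N hl0.
have [c1 e1] := lres `|w|%N hl.
have l0 : l`_0 \in l by apply: mem_nth.
have l1 : l`_`|w| \in l by apply: mem_nth.
have [h0 [i0 f0]] := lP _ l0; have [h1 [i1 f1]] := lP _ l1.
have lt01 : l`_0 < l`_`|w|.
  apply: (sorted_ltn_nth lt_trans 0 lsort) => //; rewrite ?inE; lia.
(* the arc joining the free vertices of index 0 and |w| could be added to H *)
pose b : zarc := (l`_`|w|, l`_0).
have hb : admissible w b.
  have ew : `|w|%N%:Z = - w by lia.
  have e01 : l`_`|w| - l`_0 = (c1 - c0 + 1) * (1 - w) - 1 by rewrite e0 e1 ew; lia.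
  apply/(admissibleP _ _ hw); exists (c1 - c0 + 1) => //=.
  by move: (c1 - c0) e01 => c e01; nia.
have Hb : H b.
  apply/(maxH _ hb) => a Ha _.
  have := i0 _ Ha; have := i1 _ Ha; have := f0 _ Ha; have := f1 _ Ha.
  have := unc _ Ha; have := admissible_lt _ _ (hH _ Ha).
  rewrite /endpoint /apart /b /=.
  by move: h0 h1 lt01; move: l`_0 l`_`|w| => x y; lia.
by have := i0 _ Hb; rewrite /endpoint /b /= eqxx orbT.
Qed.

(** * Maximality and the counting conditions *)

Lemma smallest_overarc_exists (H : set zarc) (v : int) (a : zarc) :
  overarc H v a -> exists c, smallest_overarc H v c.
Proof.
move=> va.
have ex : exists n, `[<exists2 c, overarc H v c & `|c.1 - c.2|%N = n>].
  by exists `|a.1 - a.2|%N; apply/asboolP; exists a.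
case: (ex_minnP ex) => n /asboolP[c vc cn] minn; exists c; split=> // b vb.
have : (n <= `|b.1 - b.2|)%N by apply: minn; apply/asboolP; exists b.
by case: vb vc => _ ? [_ ?]; lia.
Qed.

Lemma maximal_counts (w : int) (H : set zarc) :
    w <= -1 -> (forall a, H a -> admissible w a) ->
    (forall b, admissible w b -> H b <-> forall a, H a -> a <> b -> apart a b) ->
  [/\ pairwise_apart H,
      forall a, H a ->
        [set v : int | isolated H v /\ smallest_overarc H v a]
          #= `I_((`|w| - 1)%N)
    & [set v : int | isolated H v /\ (forall a, ~ overarc H v a)]
        #<= `I_(`|w|%N)].
Proof.
move=> hw hH maxH.
have apH : pairwise_apart H.
  by move=> a b Ha Hb; exact: (iffLR (maxH b (hH _ Hb)) Hb).
split=> // [a Ha|].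
  have lt_a := admissible_lt _ _ (hH _ Ha).
  have unc : uncut H (a.2 + 1) (a.1 - 1).
    move=> b Hb; have := admissible_lt _ _ (hH _ Hb).
    have [->|ab] := pselect (b = a); first by lia.
    by have := apH _ _ Hb Ha ab; rewrite /apart; lia.
  have eqL : a.1 - 1 - (a.2 + 1) + 1 = `|(a.1 - a.2 - 1)%R|%N by lia.
  have [l [lsort lP lres [c hc]]] := free_seq _ _ _ _ _ hw hH apH unc eqL.
  have sl := free_seq_lt _ _ _ _ _ hw hH maxH unc lsort
    (fun v => iffLR (lP v)) lres.
  have [k k1 hk] := iffLR (admissibleP _ _ hw) (hH _ Ha).
  have <- : size l = (`|w| - 1)%N.
    (* 0 <= size l < 1 - w and size l is -2 modulo 1 - w, where 1 - w >= 2 *)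
    have e : (size l)%:Z = (k + c) * (1 - w) - 2 by lia.
    move: (k + c) e => c' e.
    have : c' <= 1 by nia.
    have : 1 <= c' by nia.
    move=> h1 h2; have c'1 : c' = 1 by lia.
    by rewrite c'1 mul1r in e; lia.
  apply: card_eq_seq => [|v]; first exact: sorted_uniq lt_trans ltxx _ lsort.
  rewrite lP; split=> [[iv [[_ va] minv]]|[hv [iv fv]]].
    split; first by lia.
    split=> // b Hb; apply/negP => /and3P[h1 h2 h3].
    by have := minv b (conj Hb h2); lia.
  split=> //; split; first by split=> //; lia.
  move=> b [Hb vb]; have [->//|ab] := pselect (b = a).
  have := fv _ Hb; have := apH _ _ Hb Ha ab; rewrite /apart; lia.
apply: contrapT => /card_leNP[s [us sE ss]].
have s0 : s != [::] by case: s ss {us sE}.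
have [p ps minp] := seq_has_min _ _ _ s0.
(* a maximum is a minimum for the dual order *)
have [q qs maxq] := seq_has_min _ int^d _ s0.
have [ip np] := sE _ ps; have [iq nq] := sE _ qs.
have nover v a : v \in s -> H a -> ~~ (a.2 < v < a.1).
  by move=> vs Ha; apply/negP => h; have [_ /(_ a)] := sE _ vs; apply.
have unc : uncut H p q.
  move=> b Hb; have := ip _ Hb; have := iq _ Hb.
  have := nover _ _ ps Hb; have := nover _ _ qs Hb.
  by have := admissible_lt _ _ (hH _ Hb); rewrite /endpoint; lia.
have pq : p <= q by exact: minp.
have eqL : q - p + 1 = `|(q - p + 1)%R|%N by lia.
have [l [lsort lP lres _]] := free_seq _ _ _ _ _ hw hH apH unc eqL.
have := free_seq_lt _ _ _ _ _ hw hH maxH unc lsort (fun v => iffLR (lP v)) lres.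
rewrite leqNgt => /negP; apply; apply: leq_trans ss _.
apply: uniq_leq_size us _ => v vs; apply/lP; split.
  by apply/andP; split; [exact: minp | exact: maxq].
split; first by have [] := sE _ vs.
by move=> a Ha; have := nover _ _ vs Ha; lia.
Qed.

Lemma counts_maximal (w : int) (H : set zarc) :
    w <= -1 -> (forall a, H a -> admissible w a) -> pairwise_apart H ->
    (forall a, H a ->
       [set v : int | isolated H v /\ smallest_overarc H v a]
         #= `I_((`|w| - 1)%N)) ->
    [set v : int | isolated H v /\ (forall a, ~ overarc H v a)]
      #<= `I_(`|w|%N) ->
  forall b, admissible w b -> H b <-> forall a, H a -> a <> b -> apart a b.
Proof.
move=> hw hH apH counts outer b hb; split=> [Hb a Ha|apb]; first exact: apH.
apply: contrapT => nHb.
have {}apb a : H a -> apart a b.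
  by move=> Ha; apply: apb => // eab; apply: nHb; rewrite -eab.
have lt_b := admissible_lt _ _ hb.
have unc : uncut H b.2 b.1.
  move=> a Ha; have := admissible_lt _ _ (hH _ Ha); have := apb _ Ha.
  by rewrite /apart; lia.
have eqL : b.1 - b.2 + 1 = `|(b.1 - b.2 + 1)%R|%N by lia.
have [l [lsort lP _ [c hc]]] := free_seq _ _ _ _ _ hw hH apH unc eqL.
have ul : uniq l by exact: sorted_uniq lt_trans ltxx _ lsort.
have b2l : b.2 \in l.
  apply/lP; split; first by lia.
  split=> a Ha; last by lia.
  have := apb _ Ha; have := admissible_lt _ _ (hH _ Ha).
  by rewrite /endpoint /apart; lia.
(* the interval of b has a multiple of 1 - w elements, so size l is a positive
   multiple of 1 - w *)
have szl : (`|w| < size l)%N.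
  have [k k1 hk] := iffLR (admissibleP _ _ hw) hb.
  have l0 : (0 < size l)%N by case: (l) b2l.
  have e : (size l)%:Z = (k + c) * (1 - w) by lia.
  have : 1 <= k + c by nia.
  by nia.
(* every arc over a vertex of l lies over the whole of b *)
have overl v a : v \in l -> overarc H v a -> a.2 < b.2 /\ b.1 < a.1.
  move=> /lP[hv [_ fv]] [Ha va]; have := apb _ Ha; have := fv _ Ha.
  by rewrite /apart; lia.
have isol v : v \in l -> isolated H v by move=> /lP[_ []].
have [[a va]|nover] := pselect (exists a, overarc H b.2 a).
  have [c0 [vc0 minc0]] := smallest_overarc_exists _ _ _ va.
  have [Hc0 _] := vc0; have c0b := overl _ _ b2l vc0.
  have /card_eqPle[le_c0 _] := counts _ Hc0.
  suff : (size l <= `|w| - 1)%N by lia.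
  apply: seq_card_le ul _ le_c0 => v vl; split; first exact: isol.
  split; first by split=> //; move/lP: vl => [hv _]; lia.
  move=> d vd; apply: minc0; split; first by case: vd.
  by have := overl _ _ vl vd; lia.
suff : (size l <= `|w|)%N by lia.
apply: seq_card_le ul _ outer => v vl; split; first exact: isol.
move=> a va; apply: nover; exists a; split; first by case: va.
by have := overl _ _ vl va; lia.
Qed.

Theorem theorem3p4 (K : closedFieldType) (w : int) (hw : w <= -1)
    (T : triCat K) (hT : is_Tw T w)
    (M : zarc -> T) (hM : arc_model w M)
    (H : set zarc) (hH : forall a, H a -> admissible w a) :
  hom_configuration w (arc_objects M H) <->
  [/\ forall a b, H a -> H b -> a <> b ->
        ~~ crossing a b /\ ~ (exists v : int, endpoint a v && endpoint b v),
      forall a, H a ->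
        [set v : int | isolated H v /\ smallest_overarc H v a]
          #= `I_((`|w| - 1)%N)
    & [set v : int | isolated H v /\ (forall a, ~ overarc H v a)]
        #<= `I_(`|w|%N)].
Proof.
have apE a b : H a -> H b -> apart a b <->
    ~~ crossing a b /\ ~ (exists v : int, endpoint a v && endpoint b v).
  by move=> Ha Hb; apply: apartP; exact: admissible_lt (hH _ _).
rewrite (hom_configurationP _ _ _ _ _ hw hM hH); split.
  case/(maximal_counts _ _ hw hH) => apH counts outer; split=> // a b Ha Hb ab.
  by apply/apE => //; exact: apH.
case=> apH counts outer; apply: counts_maximal => // a b Ha Hb ab.
by apply/apE => //; exact: apH.
Qed.
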